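(* Let $p_1<p_2$ be finite real numbers, let $I$ be an open interval containing $[p_1,p_2]$, let $\rho>1$, $\mu\in(0,1]$ and $p_0\in I$. Suppose that $\psi:I\to\mathbb{R}$ satisfies Assumption (P$_{p_0,\rho}$) with non-vanishing factor $\tilde\psi$, that $U:(p_1,p_2]\to\mathbb{C}$ satisfies Assumption (A$_{p_1,\mu}$) with regular factor $\tilde u$ (see context), and that $\psi'$ is monotone on $\{p\in I:p<p_0\}$ and on $\{p\in I:p>p_0\}$. In addition assume that $\tilde\psi$ is right continuously differentiable at $p_0$ and that $\tilde u\in\mathcal{C}^1([p_1,p_2])$ with $\tilde u(p_1)\neq0$. Then the decay rate $\omega^{-\frac\mu\rho}$ in the estimate $$\left|\int_{p_1}^{p_2}U(p)\,e^{i\omega\psi(p)}\,dp\right|\leqslant C(U,\psi)\,\omega^{-\frac\mu\rho}\qquad(\omega>0)$$ (where $C(U,\psi)$ does not depend on $\omega$) is optimal and it is attained for $p_0=p_1$; that is, if $p_0=p_1$, then $$\limsup_{\omega\to+\infty}\ \omega^{\frac\mu\rho}\left|\int_{p_1}^{p_2}U(p)\,e^{i\omega\psi(p)}\,dp\right|>0 .$$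
   Context: Assumption (P$_{p_0,\rho}$) (with $p_0\in I$, $\rho>1$): $\psi:I\to\mathbb{R}$ belongs to $\mathcal{C}^1(I)\cap\mathcal{C}^2(I\setminus\{p_0\})$ and there exists a function $\tilde\psi:I\to\mathbb{R}$ such that $\psi'(p)=|p-p_0|^{\rho-1}\,\tilde\psi(p)$ for all $p\in I$, where $|\tilde\psi|$ is continuous on $I$ and does not vanish on $I$. The function $\tilde\psi$ is called the non-vanishing factor of $\psi$. Assumption (A$_{p_1,\mu}$) (with $\mu\in(0,1]$): for $U:(p_1,p_2]\to\mathbb{C}$ there exists $\tilde u:[p_1,p_2]\to\mathbb{C}$ such that $U(p)=(p-p_1)^{\mu-1}\,\tilde u(p)$ for all $p\in(p_1,p_2]$, where $\tilde u$ is continuous on $[p_1,p_2]$, differentiable on $(p_1,p_2)$ with $\tilde u'\in L^1(p_1,p_2)$, and $\tilde u(p_1)\neq0$ if $\mu\neq1$. The function $\tilde u$ is called the regular factor of $U$. ''$\tilde\psi$ is right continuously differentiable at $p_0$'' means, when $p_0=p_1$, that the restriction of $\tilde\psi$ to $[p_1,p_2]$ belongs to $\mathcal{C}^1([p_1,p_2])$. *)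

(* Defs.v *)
From HB Require Import structures.
From mathcomp Require Import all_boot all_order all_algebra.
From mathcomp.real_closed Require Export complex.
From mathcomp Require Import all_classical all_reals all_analysis.

Set Implicit Arguments.
Unset Strict Implicit.
Unset Printing Implicit Defensive.

Import Order.TTheory GRing.Theory Num.Theory.
Import numFieldNormedType.Exports.

Local Open Scope ring_scope.
Local Open Scope complex_scope.
Local Open Scope classical_set_scope.

(* [A] is intended to be open, so that two-sided derivatives and continuity at
   the points of [A] only depend on the restriction of [f] to [A]. *)
Definition C1_on (R : realType) (A : set R) (f : R -> R) : Prop :=
  forall p, A p -> derivable f p 1 /\ {for p, continuous f^`()}.

Definition C2_on (R : realType) (A : set R) (f : R -> R) : Prop :=
  C1_on A f /\ C1_on A f^`().

(* [f] restricted to [a, b] is C^1, with one-sided derivatives at the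
   endpoints: only the values of [f] on [a, b] matter. *)
Definition C1_segment (R : realType) (a b : R) (f : R -> R) : Prop :=
  exists2 g : R -> R, {within `[a, b], continuous g} &
    forall p, a <= p <= b ->
      (f q - f p) / (q - p) @[q --> within `[a, b] p^'] --> g p.

(* Differentiation and integration of complex-valued functions of a real
   variable are componentwise, C being identified with R^2. *)
Definition Re_fun (R : realType) (f : R -> R[i]) (p : R) : R := complex.Re (f p).
Definition Im_fun (R : realType) (f : R -> R[i]) (p : R) : R := complex.Im (f p).

Definition complex_C1_segment (R : realType) (a b : R) (f : R -> R[i]) : Prop :=
  C1_segment a b (Re_fun f) /\ C1_segment a b (Im_fun f).

Definition complex_derivable (R : realType) (f : R -> R[i]) (p : R) : Prop :=
  derivable (Re_fun f) p 1 /\ derivable (Im_fun f) p 1.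

Definition complex_derivative (R : realType) (f : R -> R[i]) (p : R) : R[i] :=
  (Re_fun f)^`() p +i* (Im_fun f)^`() p.

Definition complex_integrable (R : realType) (D : set R) (f : R -> R[i]) : Prop :=
  lebesgue_measure.-integrable D (EFin \o Re_fun f) /\
  lebesgue_measure.-integrable D (EFin \o Im_fun f).

Definition complex_integral (R : realType) (D : set R) (f : R -> R[i]) : R[i] :=
  (\int[lebesgue_measure]_(p in D) Re_fun f p)
    +i* (\int[lebesgue_measure]_(p in D) Im_fun f p).

Definition expi (R : realType) (t : R) : R[i] := cos t +i* sin t.

Definition oscillatory_integral (R : realType) (p1 p2 : R)
    (U : R -> R[i]) (psi : R -> R) (omega : R) : R[i] :=
  complex_integral `]p1, p2] (fun p => U p * expi (omega * psi p)).

(* Assumption (P_{p0,rho}) on [I], with non-vanishing factor [psit]. Only the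
   absolute value of [psit] is required to be continuous: [psit] may change
   sign at [p0]. *)
Record assumption_P (R : realType) (I : set R) (p0 rho : R)
    (psi psit : R -> R) : Prop := AssumptionP {
  P_C1 : C1_on I psi ;
  P_C2 : C2_on (I `\ p0) psi ;
  P_factor : forall p, I p -> psi^`() p = `|p - p0| `^ (rho - 1) * psit p ;
  P_continuous : {within I, continuous (fun p => `|psit p|)} ;
  P_neq0 : forall p, I p -> psit p != 0
}.

(* Assumption (A_{p1,mu}) on (p1, p2], with regular factor [ut]. [R[i]^o] selects
   the topology of C given by the modulus. *)
Record assumption_A (R : realType) (p1 p2 mu : R)
    (U ut : R -> R[i]) : Prop := AssumptionA {
  A_factor : forall p, p1 < p <= p2 ->
    U p = ((p - p1) `^ (mu - 1))%:C * ut p ;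
  A_continuous : {within `[p1, p2], continuous (ut : R -> R[i]^o)} ;
  A_derivable : forall p, p1 < p < p2 -> complex_derivable ut p ;
  A_derivative_L1 : complex_integrable `]p1, p2[ (complex_derivative ut) ;
  A_neq0 : mu != 1 -> ut p1 != 0
}.

Definition monotone_on (R : realType) (A : set R) (f : R -> R) : Prop :=
  (forall p q, A p -> A q -> p <= q -> f p <= f q) \/
  (forall p q, A p -> A q -> p <= q -> f q <= f p).

(* Main.v *)
Require Import Defs.
From HB Require Import structures.
From mathcomp Require Import all_boot all_order all_algebra.
From mathcomp Require Import all_classical all_reals all_analysis.
From mathcomp Require Import measurable_realfun.
From mathcomp Require Import ring lra.

Import Order.TTheory GRing.Theory Num.Theory.
Import numFieldNormedType.Exports.

Local Open Scope ring_scope.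
Local Open Scope complex_scope.
Local Open Scope classical_set_scope.

(** Put h p = psi p - psi p1 and alpha = mu / rho, so that 0 < alpha < 1. If the
    limit superior were 0, the integral F w would be o (w ^ (- alpha)). This is
    refuted by averaging F over frequencies with a weight whose cosine transform
    is nonnegative, which prevents cancellations.

    Multiplying F w by the conjugate of ut p1 * exp (i w psi p1) and taking real
    parts gives a real function G with |G w| <= |ut p1| |F w| and, writing
    A + i B for ut times the conjugate of ut p1,

      G w = int (p - p1) ^ (mu - 1) (A p cos (w h p) - B p sin (w h p)) dp,

    where A p1 = |ut p1| ^ 2 > 0 and B p1 = 0
    (oscillatory_integral_Re_rotated). By Fubini's theorem, the average
    J T = int_0^1 (1 - x) G (T x) dx is given by the same formula with cos and sin
    replaced by their triangular means at T h p (triangle_mean_oscillatory). The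
    mean of cos is Fejer's kernel, which is nonnegative, and both means are
    bounded by 1 and by 2 / |T h p|.

    Cauchy's mean value theorem shows that |h p| lies between two positive
    multiples of (p - p1) ^ rho (stationary_phase_two_sided). With
    T = (M d ^ rho) ^ -1, the points p <= p1 + d contribute at least a multiple of
    d ^ mu to the cosine part of J T, the other points close to p1 contribute
    nonnegatively, and those away from p1 contribute O (d ^ rho) = o (d ^ mu). The
    sine part is at most a small multiple of d ^ mu, as B is small near p1. Hence
    J T is at least a constant times d ^ mu, that is, a constant times
    T ^ (- alpha) (triangle_mean_integral_lower). But G = o (w ^ (- alpha)) would
    force J T = o (T ^ (- alpha)), since w ^ (- alpha) is integrable at 0
    (triangle_mean_decay). *)

(** * Exchanging integrals against a bounded kernel *)

(** The product of two integrable functions is integrable on the product space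
    by Tonelli's theorem, and the factor K of modulus at most 1 is harmless. *)
Lemma integrable_fubini_kernel {d1 d2 : measure_display}
    {T1 : measurableType d1} {T2 : measurableType d2} {R : realType}
    (m1 : {sigma_finite_measure set T1 -> \bar R})
    (m2 : {sigma_finite_measure set T2 -> \bar R})
    (A : set T1) (D : set T2) (w : T1 -> R) (a : T2 -> R) (K : T1 * T2 -> R) :
  measurable A -> measurable D ->
  m1.-integrable A (EFin \o w) -> m2.-integrable D (EFin \o a) ->
  measurable_fun setT K -> (forall z, `|K z| <= 1) ->
  (m1 \x m2)%E.-integrable setT
    (fun z => ((w \_ A) z.1 * (a \_ D) z.2 * K z)%:E).
Proof.
move=> mA mD iw ia mK K1.
have iw' : m1.-integrable setT (EFin \o w \_ A).
  by rewrite -restrict_EFin; apply/(integrable_mkcond _ mA).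
have ia' : m2.-integrable setT (EFin \o a \_ D).
  by rewrite -restrict_EFin; apply/(integrable_mkcond _ mD).
have /integrableP[/measurable_EFinP mw wfin] := iw'.
have /integrableP[/measurable_EFinP ma afin] := ia'.
have mF : measurable_fun setT (fun z => (w \_ A) z.1 * (a \_ D) z.2 * K z).
  apply: measurable_funM => //; apply: measurable_funM.
    exact: measurableT_comp mw measurable_fst.
  exact: measurableT_comp ma measurable_snd.
apply/integrable12ltyP; first exact/measurable_EFinP.
apply: (@le_lt_trans _ _ (\int[m1]_x (`|(w \_ A) x|%:E *
   \int[m2]_y `|((a \_ D) y)%:E|))%E).
  apply: ge0_le_integral => //=.
  - by move=> x _; exact: integral_ge0.
  - apply: (measurable_fun_fubini_tonelli_F
      (fun z => `|((w \_ A) z.1 * (a \_ D) z.2 * K z)%:E|%E)) => //.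
    by apply: measurableT_comp => //; exact/measurable_EFinP.
  - apply: emeasurable_funM => //; apply/measurable_EFinP.
    by apply: measurableT_comp mw.
  - move=> x _; rewrite -ge0_integralZl//; last first.
      by apply/measurable_EFinP; apply: measurableT_comp ma.
    apply: ge0_le_integral => //=.
    + apply/measurable_EFinP/measurableT_comp => //.
      exact: measurableT_comp mF (measurable_pair1 x).
    + apply/measurable_EFinP; apply: measurable_funM => //.
      exact: measurableT_comp.
    + move=> y _; rewrite lee_fin !normrM -[leRHS]mulr1.
      by rewrite ler_wpM2l ?mulr_ge0.
rewrite ge0_integralZr//; last 2 first.
  by apply/measurable_EFinP; exact: measurableT_comp.
  by exact: integral_ge0.
by apply: lte_mul_pinfty => //; [exact: integral_ge0|rewrite ge0_fin_numE ?integral_ge0].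
Qed.

(** Pulls the factor w x out of the inner integral and turns the extensions by
    zero back into integrals over A and D, so that Fubini's theorem, stated on
    whole spaces, applies to integrals over subsets. *)
Lemma integral_patch_kernel {d1 d2 : measure_display}
    {T1 : measurableType d1} {T2 : measurableType d2} {R : realType}
    (m2 : {sigma_finite_measure set T2 -> \bar R})
    (A : set T1) (D : set T2) (w : T1 -> R) (a : T2 -> R) (K : T1 * T2 -> R)
    (x : T1) :
  measurable D -> m2.-integrable D (EFin \o a) ->
  measurable_fun setT K -> (forall z, `|K z| <= 1) ->
  (\int[m2]_y ((w \_ A) x * (a \_ D) y * K (x, y))%:E =
   (((fun x => w x * \int[m2]_(y in D) (a y * K (x, y))) \_ A) x)%:E)%E.
Proof.
move=> mD ia mK K1.
have iaK : m2.-integrable D (EFin \o (fun y => a y * K (x, y))).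
  apply: (@integrableMl _ _ _ _ _ mD (EFin \o a) (fun y => K (x, y))) => //.
    apply: measurable_funS (@measurableT _ _) _ _ => //.
    exact: measurableT_comp mK (measurable_pair1 x).
  exists 1; split=> // M M1 y _; exact: le_trans (K1 _) (ltW M1).
rewrite [in RHS]patchE; case: ifPn => xA; last first.
  under eq_integral do rewrite patchE (negbTE xA) !mul0r.
  by rewrite integral0.
rewrite -RintegralZl// Rintegral_mkcond /Rintegral fineK.
  apply: eq_integral => y _; congr EFin.
  by rewrite !patchE xA; case: ifP; rewrite ?mulrA// mulr0 mul0r.
apply: integrable_fin_num => //.
have /(integrable_mkcond _ mD) := integrableZl mD (w x) iaK.
by rewrite restrict_EFin.
Qed.

(** Exchange of integrals for a bounded kernel, together with the integrability
    of both partial integrals, which linearity of the real integral requires. *)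
Lemma Rintegral_fubini_kernel {d1 d2 : measure_display}
    {T1 : measurableType d1} {T2 : measurableType d2} {R : realType}
    (m1 : {sigma_finite_measure set T1 -> \bar R})
    (m2 : {sigma_finite_measure set T2 -> \bar R})
    (A : set T1) (D : set T2) (w : T1 -> R) (a : T2 -> R) (K : T1 * T2 -> R) :
  measurable A -> measurable D ->
  m1.-integrable A (EFin \o w) -> m2.-integrable D (EFin \o a) ->
  measurable_fun setT K -> (forall z, `|K z| <= 1) ->
  let F := (fun x => w x * \int[m2]_(y in D) (a y * K (x, y))) in
  let G := (fun y => a y * \int[m1]_(x in A) (w x * K (x, y))) in
  [/\ m1.-integrable A (EFin \o F), m2.-integrable D (EFin \o G) &
      \int[m1]_(x in A) F x = \int[m2]_(y in D) G y].
Proof.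
move=> mA mD iw ia mK K1 F G.
have H := integrable_fubini_kernel m1 m2 A D w a K mA mD iw ia mK K1.
have H' : (m2 \x m1)%E.-integrable setT
    (fun z => ((a \_ D) z.1 * (w \_ A) z.2 * K (unstable.swap z))%:E).
  apply: (integrable_fubini_kernel m2 m1 D A a w (K \o unstable.swap)) => //.
    by apply: measurableT_comp mK _; exact: measurable_swap.
  by move=> z; exact: (K1 (unstable.swap z)).
have FE x : (\int[m2]_y ((w \_ A) x * (a \_ D) y * K (x, y))%:E =
    ((F \_ A) x)%:E)%E.
  exact: integral_patch_kernel.
have GE y : (\int[m1]_x ((w \_ A) x * (a \_ D) y * K (x, y))%:E =
    ((G \_ D) y)%:E)%E.
  rewrite -(@integral_patch_kernel _ _ _ _ _ m1 D A a w
    (K \o unstable.swap)) //.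
    by apply: eq_integral => x _ /=; rewrite [_ * (w \_ A) x]mulrC.
    by apply: measurableT_comp mK _; exact: measurable_swap.
  by move=> z; exact: (K1 (unstable.swap z)).
split.
- apply/(integrable_mkcond _ mA); rewrite restrict_EFin.
  have := integrable_fubini_F H; apply: eq_integrable => //= x _.
  exact: FE.
- apply/(integrable_mkcond _ mD); rewrite restrict_EFin.
  have := integrable_fubini_F H'; apply: eq_integrable => //= y _.
  rewrite -GE; apply: eq_integral => x _ /=; rewrite /unstable.swap/=.
  by rewrite [_ * (w \_ A) x]mulrC.
- rewrite /Rintegral; congr fine.
  rewrite integral_mkcond [RHS]integral_mkcond !restrict_EFin.
  under eq_integral do rewrite /= -FE.
  under [RHS]eq_integral do rewrite /= -GE.
  exact: (Fubini H).
Qed.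

(** * Integrals of shifted powers *)

Lemma measurable_powR_subr {R : realType} (D : set R) (a s : R) :
  measurable_fun D (fun x : R => (x - a) `^ s).
Proof.
apply: measurable_funS (@measurableT _ _) _ _ => //.
apply: (measurableT_comp (measurable_powR _)).
exact: measurable_funB.
Qed.

Lemma is_derive_powR_subr {R : realType} (a s x : R) : a < x ->
  is_derive x 1 (fun y => (y - a) `^ s) (s * (x - a) `^ (s - 1)).
Proof.
move=> ax.
have xa : 0 < x - a by rewrite subr_gt0.
have dB : is_derive x 1 (fun y : R => y - a) (1 - 0).
  exact: is_deriveB (is_derive_id x 1) (is_derive_cst a x 1).
have := @is_derive1_comp R (fun y => y `^ s) (fun y => y - a) x _ _ (is_derive1_powR s xa) dB.
by rewrite subr0 mulr1.
Qed.

Lemma integral_powR_subr {R : realType} (a c b s : R) : a < c -> c <= b ->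
  s != 0 ->
  (\int[lebesgue_measure]_(x in `[c, b]) ((x - a) `^ (s - 1))%:E =
   (((b - a) `^ s - (c - a) `^ s) / s)%:E)%E.
Proof.
move=> ac; rewrite le_eqVlt => /predU1P[<-|cb] s0.
  by rewrite set_itv1 integral_set1 subrr mul0r.
have D x : a < x -> is_derive x 1 (fun y => (y - a) `^ s / s) ((x - a) `^ (s - 1)).
  move=> ax; have dP := is_derive_powR_subr a s x ax.
  have := is_deriveZ (s^-1 : R) dP.
  rewrite (_ : _ \*: _ = (fun y => (y - a) `^ s / s)); last first.
    by apply/funext => y /=; rewrite mulrC.
  by rewrite /GRing.scale/= mulrA mulVf// mul1r.
have C (r x : R) : a < x -> {for x, continuous (fun y => (y - a) `^ r)}.
  move=> ax; apply/differentiable_continuous/derivable1_diffP.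
  by have [] := is_derive_powR_subr a r x ax.
have C' x : a < x -> {for x, continuous (fun y => (y - a) `^ s / s)}.
  by move=> ax; apply: cvgM; [exact: C|exact: cvg_cst].
rewrite (@continuous_FTC2 _ _ (fun y => (y - a) `^ s / s)) //.
- by rewrite -EFinB mulrBl.
- apply: continuous_in_subspaceT => x; rewrite inE/= in_itv/= => /andP[cx _].
  by apply: C; exact: lt_le_trans cx.
- split.
  + by move=> x; rewrite in_itv/= => /andP[cx _]; have [] := D x (lt_trans ac cx).
  + by apply: cvg_at_right_filter; exact: C'.
  + by apply: cvg_at_left_filter; apply: C'; exact: lt_trans cb.
- move=> x; rewrite in_itv/= => /andP[cx _].
  by rewrite derive1E; have [_ ->] := D x (lt_trans ac cx).
Qed.

(** For s < 1 the integrand is singular at a, so the fundamental theorem of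
    calculus is applied away from a, followed by monotone convergence. *)
Lemma integral_powR_subr0 {R : realType} (a b s : R) : a < b -> 0 < s ->
  (\int[lebesgue_measure]_(x in `]a, b]) ((x - a) `^ (s - 1))%:E =
   ((b - a) `^ s / s)%:E)%E.
Proof.
move=> ab s0.
(* The singular endpoint is removed by exhausting ]a, b] with the closed
   intervals [a + (b - a) / n.+1, b]; the first one is the point b. *)
pose F (n : nat) := `[a + (b - a) / n.+1%:R, b]%classic : set R.
have ba : 0 < b - a by rewrite subr_gt0.
have dn (n : nat) : 0 < (b - a) / n.+1%:R by rewrite divr_gt0.
have dle (n : nat) : a + (b - a) / n.+1%:R <= b.
  rewrite -lerBrDl ler_pdivrMr// -[leLHS]mulr1 ler_pM2l//.
  by rewrite ler1n.
have UF : \bigcup_i F i = `]a, b].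
  rewrite eqEsubset; split => x /=.
    move=> [n _]; rewrite /F/= !in_itv/= => /andP[xl ->]; rewrite andbT.
    by apply: lt_le_trans xl; rewrite ltrDl.
  rewrite in_itv/= => /andP[ax xb].
  have xa : 0 < x - a by rewrite subr_gt0.
  exists (Num.bound ((b - a) / (x - a))) => //.
  rewrite /F/= in_itv/= xb andbT -lerBrDl ler_pdivrMr// mulrC -ler_pdivrMr//.
  apply/ltW/(lt_le_trans (archi_boundP _)); first by rewrite divr_ge0// ltW.
  by rewrite ler_nat.
have mpow : measurable_fun setT (fun x : R => ((x - a) `^ (s - 1))%:E).
  by apply/measurable_EFinP; apply: measurable_powR_subr.
have := @ge0_nondecreasing_set_cvg_integral _ (measurableTypeR R) R F
  (fun x => ((x - a) `^ (s - 1))%:E) (@lebesgue_measure R).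
rewrite UF => cF; apply: (cvg_unique _ (cF _ _ _ _)) => //.
- move=> m n mn; apply/subsetPset => x; rewrite /F/= !in_itv/= => /andP[xl ->].
  rewrite andbT; apply: le_trans xl; rewrite lerD2l ler_pM2l// lef_pV2 ?posrE//.
  by rewrite ler_nat.
- by move=> n; exact: measurable_itv.
- by move=> n; apply: measurable_funS mpow.
- by move=> n x _; rewrite lee_fin powR_ge0.
rewrite (_ : (fun n => _) = (fun n : nat =>
    (((b - a) `^ s - ((b - a) / n.+1%:R) `^ s) / s)%:E)); last first.
  apply/funext => n; rewrite integral_powR_subr ?ltrDl// ?gt_eqF//.
  by rewrite [a + _]addrC addrK.
apply: cvg_EFin; first by near=> n.
rewrite /comp/=.
rewrite -[X in _ --> X / s]subr0.
apply: cvgM; last exact: cvg_cst.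
apply: cvgB; first exact: cvg_cst.
have : ((b - a) / n.+1%:R) @[n --> \oo] --> (0 : R).
  rewrite -[X in _ --> X](mulr0 (b - a)).
  by apply: cvgM; [exact: cvg_cst|exact: cvg_harmonic].
move=> H.
apply: (@cvg_comp _ _ _ (fun n : nat => (b - a) / n.+1%:R) (fun x => x `^ s) _ (0^'+)); last exact: powR_cvg0.
move=> A [e /= e0 eA].
have /cvgrPdist_lt/(_ _ e0) := H.
apply: filterS => n /= ne; apply: eA => //=.
Unshelve. all: by end_near. Qed.

Lemma Rintegral_powR_subr0 {R : realType} (a b s : R) : a < b -> 0 < s ->
  lebesgue_measure.-integrable `]a, b] (fun x => ((x - a) `^ (s - 1))%:E) /\
  \int[lebesgue_measure]_(x in `]a, b]) ((x - a) `^ (s - 1)) = (b - a) `^ s / s.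
Proof.
move=> ab s0; have E := integral_powR_subr0 _ _ _ ab s0; split; last first.
  by rewrite /Rintegral E.
apply/integrableP; split; first by apply/measurable_EFinP; apply: measurable_powR_subr.
under eq_integral do rewrite gee0_abs ?lee_fin ?powR_ge0//.
by rewrite E ltry.
Qed.

Lemma Rintegral_powR_subr {R : realType} (a c b s : R) : a < c -> c <= b ->
  s != 0 ->
  lebesgue_measure.-integrable `]c, b] (fun x => ((x - a) `^ (s - 1))%:E) /\
  \int[lebesgue_measure]_(x in `]c, b]) ((x - a) `^ (s - 1)) =
    ((b - a) `^ s - (c - a) `^ s) / s.
Proof.
move=> ac cb s0; have E := integral_powR_subr _ _ _ _ ac cb s0.
have i : lebesgue_measure.-integrable `[c, b] (fun x => ((x - a) `^ (s - 1))%:E).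
  apply/integrableP; split; first by apply/measurable_EFinP; apply: measurable_powR_subr.
  under eq_integral do rewrite gee0_abs ?lee_fin ?powR_ge0//.
  by rewrite E ltry.
have i' : lebesgue_measure.-integrable `]c, b] (fun x => ((x - a) `^ (s - 1))%:E).
  by apply: integrableS i => //; exact: subset_itv_oc_cc.
split => //.
by rewrite Rintegral_itv_obnd_cbnd// /Rintegral E.
Qed.

(** * Continuous functions on a segment *)

Lemma within_continuous_near_right {R : realType} (a b e : R) (f : R -> R) :
  a < b -> {within `[a, b], continuous f} -> 0 < e ->
  exists2 d : R, 0 < d & forall x, a < x <= b -> x - a <= d -> `|f x - f a| <= e.
Proof.
move=> ab /(continuous_within_itvP _ ab)[_ + _] e0.
move/cvgrPdist_le => /(_ _ e0)[d /= d0 H].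
exists (d / 2); first by rewrite divr_gt0.
move=> x /andP[ax xb] xd; rewrite distrC; apply: H => //=.
rewrite distrC gtr0_norm ?subr_gt0// (le_lt_trans xd)//.
by rewrite ltr_pdivrMr// ltr_pMr// ltr1n.
Qed.

Lemma within_continuous_bounded {R : realType} (a b : R) (f : R -> R) :
  a <= b -> {within `[a, b], continuous f} ->
  exists2 K : R, 0 < K & forall x, a <= x <= b -> `|f x| <= K.
Proof.
move=> ab cf.
have cn : {within `[a, b], continuous (fun x => `|f x|)}.
  by move=> x; apply: cvg_norm; exact: cf.
have [c _ cmax] := EVT_max ab cn.
exists (`|f c| + 1); first by rewrite ltr_wpDl.
by move=> x xab; rewrite (le_trans (cmax x _)) ?in_itv// lerDl.
Qed.

Lemma integrable_powR_continuous {R : realType} (a b s : R) (g : R -> R) :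
  a < b -> 0 < s -> {within `[a, b], continuous g} ->
  lebesgue_measure.-integrable `]a, b]
    (EFin \o (fun x : R => (x - a) `^ (s - 1) * g x)).
Proof.
move=> ab s0 cg.
have [i _] := Rintegral_powR_subr0 a b s ab s0.
have mI : measurable (`]a, b]%classic : set (measurableTypeR R)) by [].
apply: (integrableMl mI i).
  have mg : measurable_fun `[a, b] g by exact: subspace_continuous_measurable_fun.
  by apply: measurable_funS mg => //; exact: subset_itv_oc_cc.
have [K K0 HK] := within_continuous_bounded _ _ _ (ltW ab) cg.
exists K; split; first exact: num_real.
move=> L KL x; rewrite /= in_itv/= => /andP[ax xb].
by apply: le_trans (HK x _) (ltW KL); rewrite ltW.
Qed.

(** * Triangular means of cosine and sine *)

(** For k = cos this is Fejer's kernel (1 - cos s) / s ^ 2. *)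
Definition triangle_mean {R : realType} (k : R -> R) (s : R) : R :=
  \int[lebesgue_measure]_(x in `[0, 1]) ((1 - x) * k (x * s)).

Lemma continuous_triangle_integrand {R : realType} (k : R -> R) (s : R) :
  continuous k -> continuous (fun x : R => (1 - x) * k (x * s)).
Proof.
move=> ck x; apply: cvgM; first by apply: cvgB; [exact: cvg_cst|exact: cvg_id].
have cm : {for x, continuous (fun x : R => x * s)}.
  by apply: cvgM; [exact: cvg_id|exact: cvg_cst].
exact: continuous_comp cm (ck _).
Qed.

Lemma integrable_unit_itv {R : realType} (f : R -> R) :
  continuous f -> lebesgue_measure.-integrable `[0, 1] (EFin \o f).
Proof.
move=> cf; apply: continuous_compact_integrable; first exact: segment_compact.
exact: continuous_subspaceT.
Qed.

Lemma Rintegral_unit_itv_FTC {R : realType} (f F : R -> R) :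
  continuous f -> (forall x : R, is_derive x 1 F (f x)) ->
  \int[lebesgue_measure]_(x in `[0, 1]) f x = F 1 - F 0.
Proof.
move=> cf dF; rewrite /Rintegral (@continuous_FTC2 _ _ F)//.
- exact: continuous_subspaceT.
- have cF x : {for x, continuous F}.
    by apply/differentiable_continuous/derivable1_diffP; have [] := dF x.
  split; first by move=> x _; have [] := dF x.
  + by apply: cvg_at_right_filter; exact: cF.
  + by apply: cvg_at_left_filter; exact: cF.
- by move=> x _; rewrite derive1E; have [_ ->] := dF x.
Qed.

(** Two integrations by parts, F1 and F2 being successive antiderivatives of k. *)
Lemma triangle_mean_antiderivE {R : realType} (k F1 F2 : R -> R) (s : R) : s != 0 ->
  continuous k ->
  (forall x : R, is_derive x 1 F1 (k x)) -> (forall x : R, is_derive x 1 F2 (F1 x)) ->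
  triangle_mean k s = (F2 s - F2 0) / s ^+ 2 - F1 0 / s.
Proof.
move=> s0 ck dF1 dF2.
have dM (x : R) : is_derive x 1 (fun x : R => x * s) s.
  have := is_deriveM (is_derive_id x 1) (is_derive_cst s x 1).
  by rewrite scaler0 add0r /GRing.scale/= mulr1.
have dF (x : R) : is_derive x 1
    (fun x : R => (1 - x) * (F1 (x * s) * s^-1) + F2 (x * s) * (s ^- 2))
    ((1 - x) * k (x * s)).
  have d1 := @is_derive1_comp R F1 (fun x => x * s) x _ _ (dF1 (x * s)) (dM x).
  have d2 := @is_derive1_comp R F2 (fun x => x * s) x _ _ (dF2 (x * s)) (dM x).
  have e1 := is_deriveM (is_deriveB (is_derive_cst (1 : R) x 1) (is_derive_id x 1))
     (is_deriveM d1 (is_derive_cst s^-1 x 1)).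
  have e2 := is_deriveD e1 (is_deriveM d2 (is_derive_cst (s ^- 2) x 1)).
  apply: is_derive_eq e2 _.
  rewrite !scaler0 /GRing.scale/= !fctE/=; field.
  by [].
rewrite /triangle_mean (Rintegral_unit_itv_FTC _ _ (continuous_triangle_integrand k s ck) dF).
by rewrite subrr mul0r !mul0r mul1r subr0; field.
Qed.

Lemma triangle_mean_cosE {R : realType} (s : R) : s != 0 ->
  triangle_mean cos s = (1 - cos s) / s ^+ 2.
Proof.
move=> s0.
have dNcos (x : R) : is_derive x 1 (fun x => - cos x) (sin x).
  by have := is_deriveN (is_derive_cos x); rewrite opprK.
rewrite (triangle_mean_antiderivE _ _ _ s s0 (@continuous_cos R) (@is_derive_sin R) dNcos).
by rewrite sin0 cos0 mul0r subr0 opprK addrC.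
Qed.

Lemma triangle_mean_sinE {R : realType} (s : R) : s != 0 ->
  triangle_mean sin s = s^-1 - sin s / s ^+ 2.
Proof.
move=> s0.
have dNcos (x : R) : is_derive x 1 (fun x => - cos x) (sin x).
  by have := is_deriveN (is_derive_cos x); rewrite opprK.
have dNsin (x : R) : is_derive x 1 (fun x => - sin x) (- cos x).
  exact: is_deriveN (is_derive_sin x).
rewrite (triangle_mean_antiderivE _ _ _ s s0 (@continuous_sin R) dNcos dNsin).
by rewrite sin0 cos0 oppr0 subr0 mulN1r opprK mulNr addrC.
Qed.

Lemma triangle_mean_le1 {R : realType} (k : R -> R) (s : R) :
  continuous k -> (forall x, `|k x| <= 1) -> `|triangle_mean k s| <= 1.
Proof.
move=> ck k1.
have ic := integrable_unit_itv _ (continuous_triangle_integrand k s ck).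
apply: le_trans; first exact: le_normr_Rintegral.
apply: (@le_trans _ _ (\int[@lebesgue_measure R]_(x in `[0, 1]) (1 : R))); last first.
  by rewrite Rintegral_cst//= lebesgue_measure_itv/= lte_fin ltr01/= subr0 mulr1.
apply: le_Rintegral => //.
- exact: integrable_norm.
- by apply: integrable_unit_itv => x; exact: cvg_cst.
- move=> x; rewrite /= in_itv/= => /andP[x0 x1].
  rewrite normrM -[leRHS]mulr1 ler_pM// ger0_norm ?subr_ge0//.
  by rewrite gerBl.
Qed.

Lemma triangle_mean_cos_ge0 {R : realType} (s : R) : 0 <= triangle_mean cos s.
Proof.
have [->|s0] := eqVneq s 0.
  apply: Rintegral_ge0 => x; rewrite /= in_itv/= => /andP[x0 x1].
  by rewrite mulr0 cos0 mulr1 subr_ge0.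
by rewrite triangle_mean_cosE// divr_ge0 ?sqr_ge0// subr_ge0 cos_le1.
Qed.

(** The product form includes s = 0: the closed form
    gives the bound for |s| > 1, the trivial bound 1 gives it for |s| <= 1. *)
Lemma triangle_mean_cos_decay {R : realType} (s : R) :
  `|s| * `|triangle_mean cos s| <= 2.
Proof.
have c1 := triangle_mean_le1 _ s (@continuous_cos R) (@cos_max R).
have [s1|s1] := leP `|s| 1.
  by rewrite (le_trans (ler_pM _ _ s1 c1))// mulr1 ler1n.
have s0 : s != 0 by rewrite -normr_gt0 (lt_trans ltr01).
rewrite triangle_mean_cosE// normrM normfV normrX mulrA ler_pdivrMr ?exprn_gt0 ?normr_gt0//.
have : `|1 - cos s| <= 2.
  by rewrite ler_norml; have := cos_le1 s; have := cos_geN1 s; lra.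
by nra.
Qed.

(** Unlike the cosine mean, this one only decays like 1 / s; this suffices since
    s is of order (p - p1) ^ rho with rho larger than the exponent mu. *)
Lemma triangle_mean_sin_decay {R : realType} (s : R) :
  `|s| * `|triangle_mean sin s| <= 2.
Proof.
have c1 := triangle_mean_le1 _ s (@continuous_sin R) (@sin_max R).
have [s1|s1] := leP `|s| 1.
  by rewrite (le_trans (ler_pM _ _ s1 c1))// mulr1 ler1n.
have s0 : s != 0 by rewrite -normr_gt0 (lt_trans ltr01).
rewrite triangle_mean_sinE// -normrM mulrBr divff// (le_trans (ler_normB _ _))//.
rewrite normr1 -[leRHS]/(1 + 1) lerD2l !normrM normfV normrX expr2 mulrC.
rewrite -mulrA invfM mulrVK ?unitfE ?normr_eq0// ler_pdivrMr ?normr_gt0// mul1r.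
exact: le_trans (sin_max _) (ltW s1).
Qed.

(** For |s| <= 1 all the values cos (x * s) are at least cos 1, and the weight
    has mass 1 / 2. *)
Lemma triangle_mean_cos_near0 {R : realType} (s : R) : `|s| <= 1 ->
  cos 1 / 2 <= triangle_mean cos s.
Proof.
move=> s1.
have <- : \int[@lebesgue_measure R]_(x in `[0, 1]) ((1 - x) * cos 1) = cos 1 / 2.
  have dF (x : R) : is_derive x 1 (fun x : R => cos 1 * (x - x * x / 2))
      ((1 - x) * cos 1).
    have e := is_deriveM (is_derive_cst (cos 1 : R) x 1)
      (is_deriveB (is_derive_id x 1) (is_deriveM
        (is_deriveM (is_derive_id x 1) (is_derive_id x 1))
        (is_derive_cst (2^-1 : R) x 1))).
    apply: is_derive_eq e _.
    by rewrite !scaler0 /GRing.scale/= ?fctE/=; field.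
  rewrite (Rintegral_unit_itv_FTC _ _ _ dF); first by field.
  by apply: (@continuous_triangle_integrand _ (fun=> cos 1) 1) => x; exact: cvg_cst.
apply: le_Rintegral => //.
- apply: integrable_unit_itv.
  by apply: (@continuous_triangle_integrand _ (fun=> cos 1) 1) => x; exact: cvg_cst.
- by apply: integrable_unit_itv; apply/continuous_triangle_integrand/continuous_cos.
- move=> x; rewrite /= in_itv/= => /andP[x0 x1].
  rewrite ler_wpM2l ?subr_ge0//.
  rewrite -(cos_norm (x * s)).
  have xs : `|x * s| <= 1 by rewrite normrM ger0_norm// mulr_ile1.
  have pi1 : 1 <= pi :> R by have := pi_ge2 R; lra.
  rewrite leNgt ltr_cos ?in_itv/= ?normr_ge0 ?ler01 ?(le_trans xs)//.
  by rewrite -leNgt.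
Qed.

(** * Averages of the oscillatory integral over frequencies *)

(** The decay of the triangular means at T * h p, with T = (M * dr) ^ -1, in terms
    of the ratio dr / xr, where dr = d ^ rho and xr = (p - p1) ^ rho. *)
Lemma rescaled_decay {R : realType} (m M dr xr y t : R) :
  0 < m -> 0 < M -> 0 < dr -> 0 < xr -> m * xr <= `|y| ->
  `|(M * dr)^-1 * y| * `|t| <= 2 -> `|t| <= 2 * M / m * dr / xr.
Proof.
move=> m0 M0 dr0 xr0 hy.
have Md0 : 0 < M * dr by rewrite mulr_gt0.
have Mi0 : 0 < (M * dr)^-1 by rewrite invr_gt0.
rewrite normrM (gtr0_norm Mi0) => yt; rewrite -mulrA ler_pdivrMl// in yt.
rewrite (_ : 2 * M / m * dr / xr = M * dr * 2 / (m * xr)); last first.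
  by field; rewrite !gt_eqF.
rewrite ler_pdivlMr ?mulr_gt0// mulrC.
by apply: le_trans yt; rewrite ler_wpM2r.
Qed.

(** The lower bound for the averaged integral, at the frequency scale
    T = (M d ^ rho) ^ -1, for which |T * h p| <= 1 as soon as p - p1 <= d. On
    p1 < p <= p1 + d the cosine term contributes at least a multiple of d ^ mu,
    since A is close to A p1 > 0. As long as A stays positive, the cosine term is
    nonnegative, like the triangular mean. The sine term near p1 has the same
    order d ^ mu, but with a factor as small as desired since B vanishes at p1.
    Away from p1 both terms are O (d ^ rho), hence negligible. *)
Lemma triangle_mean_integral_lower {R : realType} (p1 p2 mu rho m M : R)
    (A B h : R -> R) :
  p1 < p2 -> 0 < mu -> mu < rho -> 0 < m -> 0 < M ->
  {within `[p1, p2], continuous A} -> {within `[p1, p2], continuous B} ->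
  0 < A p1 -> B p1 = 0 ->
  (forall p, p1 < p <= p2 ->
    m * (p - p1) `^ rho <= `|h p| <= M * (p - p1) `^ rho) ->
  let f T p := (p - p1) `^ (mu - 1) *
    (A p * triangle_mean cos (T * h p) - B p * triangle_mean sin (T * h p)) in
  (forall T, lebesgue_measure.-integrable `]p1, p2] (EFin \o f T)) ->
  exists2 c, 0 < c & \forall d \near 0^'+,
    c * d `^ mu <= \int[lebesgue_measure]_(p in `]p1, p2]) f (M * d `^ rho)^-1 p.
Proof.
move=> p12 mu0 murho m0 M0 cA cB A0 B0 hb f fi.
have c10 : 0 < cos 1 / 2 :> R by rewrite divr_gt0 ?cos1_gt0.
set c1 := cos 1 / 2 in c10.
have [q qE q0] : exists2 q, q = 2 * M / m & 0 < q.
  by exists (2 * M / m) => //; rewrite divr_gt0 ?mulr_gt0.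
have rm0 : 0 < rho - mu by rewrite subr_gt0.
(* E d ^ mu bounds the integral of x ^ (mu - 1) min (1, q (d / x) ^ rho), where
   x = p - p1: this controls the sine term through |B| <= e1 near p1. *)
pose E := mu^-1 + q / (rho - mu).
have E0 : 0 < E by rewrite addr_gt0// ?invr_gt0// divr_gt0.
have [c0 c0E c00] : exists2 c0, c0 = c1 * A p1 / (2 * mu) & 0 < c0.
  by exists (c1 * A p1 / (2 * mu)) => //; apply: divr_gt0; apply: mulr_gt0.
(* e1 is chosen so that the sine term costs at most half of the cosine term. *)
have [e1 e1E e10] : exists2 e1, e1 = c0 / (2 * E) & 0 < e1.
  exists (c0 / (2 * E)) => //.
  by apply: divr_gt0 => //; apply: mulr_gt0.
have A20 : 0 < A p1 / 2 by rewrite divr_gt0.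
have [dA dA0 HA] := within_continuous_near_right _ _ _ _ p12 cA A20.
have [dB dB0 HB] := within_continuous_near_right _ _ _ _ p12 cB e10.
have [KA KA0 HKA] := within_continuous_bounded _ _ _ (ltW p12) cA.
have [KB KB0 HKB] := within_continuous_bounded _ _ _ (ltW p12) cB.
pose d0 := Num.min dA dB.
have d00 : 0 < d0 by rewrite lt_min dA0.
(* F d ^ rho x ^ (mu - 1) bounds the integrand where p - p1 > d0; it is
   negligible because rho > mu. *)
have [F FE F0] : exists2 F, F = (KA + KB) * q * d0 `^ (- rho) & 0 < F.
  exists ((KA + KB) * q * d0 `^ (- rho)) => //.
  by rewrite !mulr_gt0// ?addr_gt0// powR_gt0.
pose F' := F * ((p2 - p1) `^ mu / mu).
have L0 : 0 < p2 - p1 by rewrite subr_gt0.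
have F'0 : 0 < F'.
  by apply: mulr_gt0 => //; apply: divr_gt0 => //; exact: powR_gt0.
have e20 : 0 < c0 / 4 / F' by apply: divr_gt0 => //; apply: divr_gt0.
exists (c0 / 4); first by rewrite divr_gt0.
near=> d.
have dgt0 : 0 < d by near: d; exact: nbhs_right_gt.
have dd0 : d <= d0 by near: d; exact: nbhs_right_le.
have dL : d <= p2 - p1 by near: d; exact: nbhs_right_le.
have dsmall : F' * d `^ (rho - mu) <= c0 / 4.
  rewrite mulrC -ler_pdivlMr//.
  near: d; have /cvgrPdist_le/(_ _ e20) := powR_cvg0 rm0.
  by apply: filterS => x; rewrite sub0r normrN ger0_norm ?powR_ge0.
set T := (M * d `^ rho)^-1.
have dr0 : 0 < d `^ rho by rewrite powR_gt0.
have T0 : 0 < T by rewrite invr_gt0 mulr_gt0.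
have mid1 : p1 < p1 + d by rewrite ltrDl.
have mid2 : p1 + d <= p2 by rewrite -lerBrDl.
(* For p - p1 <= d the argument T * h p is at most 1 in absolute value. *)
have near_part p : p1 < p <= p1 + d ->
    (c1 * (A p1 / 2) - e1) * (p - p1) `^ (mu - 1) <= f T p.
  move=> /andP[p1p pd].
  have pp : p1 < p <= p2 by rewrite p1p (le_trans pd).
  have x0 : 0 < p - p1 by rewrite subr_gt0.
  have xd : p - p1 <= d by rewrite lerBlDl.
  rewrite mulrC ler_wpM2l ?powR_ge0//.
  have hA : A p1 / 2 <= A p.
    have := HA p pp (le_trans xd _); rewrite le_min in dd0.
    case/andP: dd0 => -> _ /(_ isT); rewrite ler_norml; lra.
  have hB : `|B p| <= e1.
    have := HB p pp (le_trans xd _); rewrite le_min in dd0.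
    by case/andP: dd0 => _ -> /(_ isT); rewrite B0 subr0.
  have Th : `|T * h p| <= 1.
    rewrite normrM gtr0_norm// mulrC ler_pdivrMr ?mulr_gt0// mul1r.
    have /andP[_] := hb p pp; move/le_trans; apply.
    rewrite ler_pM2l// ge0_ler_powR//; first exact/ltW/(lt_trans mu0).
      by rewrite nnegrE ltW.
    by rewrite nnegrE ltW.
  have hC := triangle_mean_cos_near0 _ Th; rewrite -/c1 in hC.
  have hS := triangle_mean_le1 _ (T * h p) (@continuous_sin R) (@sin_max R).
  apply: lerB; first by rewrite mulrC ler_pM// ltW.
  rewrite (le_trans (ler_norm _))// normrM -[leRHS]mulr1 ler_pM//.
have far_part p : p1 + d < p <= p2 ->
    - (e1 * q * d `^ rho) * (p - p1) `^ (mu - rho - 1) +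
    - (F * d `^ rho) * (p - p1) `^ (mu - 1) <= f T p.
  move=> /andP[pd pp2].
  have p1p : p1 < p by exact: lt_trans pd.
  have pp : p1 < p <= p2 by rewrite p1p.
  have pp' : p1 <= p <= p2 by rewrite ltW.
  have x0 : 0 < p - p1 by rewrite subr_gt0.
  have xr0 : 0 < (p - p1) `^ rho by rewrite powR_gt0.
  have -> : (p - p1) `^ (mu - rho - 1) = (p - p1) `^ (mu - 1) / (p - p1) `^ rho.
    by rewrite [mu - rho - 1]addrAC powRB// (gt_eqF x0) implybT.
  set P := (p - p1) `^ (mu - 1); set xr := (p - p1) `^ rho in xr0 *.
  have P0 : 0 <= P by exact: powR_ge0.
  rewrite (_ : _ + _ = P * (- (e1 * q * d `^ rho / xr) - F * d `^ rho)); last by ring.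
  rewrite /f -/P; apply: ler_wpM2l => //.
  have /andP[hlow _] := hb p pp.
  have decay (t : R) : `|T * h p| * `|t| <= 2 -> `|t| <= q * d `^ rho / xr.
    by rewrite qE; apply: (rescaled_decay m M (d `^ rho) xr (h p)).
  have hC := decay _ (triangle_mean_cos_decay (T * h p)).
  have hS := decay _ (triangle_mean_sin_decay (T * h p)).
  have Q0 : 0 <= q * d `^ rho / xr := le_trans (normr_ge0 _) hC.
  have Fd0 : 0 <= F * d `^ rho by rewrite mulr_ge0// ltW.
  rewrite -!mulrA in Q0 hC hS *.
  (* Up to d0 the cosine term is nonnegative and B is small; beyond d0 both
     terms are bounded through (d / x) ^ rho <= (d / d0) ^ rho. *)
  have [xd0|xd0] := leP (p - p1) d0.
    have hA : 0 <= A p.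
      have := HA p pp (le_trans xd0 _); rewrite ge_min lexx => /(_ isT).
      by rewrite ler_norml; lra.
    have hB : `|B p| <= e1.
      have := HB p pp (le_trans xd0 _); rewrite ge_min lexx orbT => /(_ isT).
      by rewrite B0 subr0.
    have AC0 := mulr_ge0 hA (triangle_mean_cos_ge0 (T * h p)).
    have : `|B p * triangle_mean sin (T * h p)| <= e1 * (q * (d `^ rho / xr)).
      by rewrite normrM; apply: ler_pM.
    by rewrite ler_norml; lra.
  have hAC : `|A p * triangle_mean cos (T * h p)| <= KA * (q * (d `^ rho / xr)).
    by rewrite normrM; apply: ler_pM => //; exact: HKA.
  have hBS : `|B p * triangle_mean sin (T * h p)| <= KB * (q * (d `^ rho / xr)).
    by rewrite normrM; apply: ler_pM => //; exact: HKB.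
  have hF : (KA + KB) * (q * (d `^ rho / xr)) <= F * d `^ rho.
    rewrite FE powRN -!mulrA ler_pM2l ?addr_gt0// ler_pM2l// mulrC.
    rewrite ler_pM2r// lef_pV2 ?posrE ?powR_gt0//.
    rewrite ge0_ler_powR//; first exact/ltW/(lt_trans mu0).
    - by rewrite nnegrE ltW.
    - by rewrite nnegrE ltW.
    - exact: ltW.
  have e1q : 0 <= e1 * (q * (d `^ rho / xr)) by rewrite mulr_ge0// ltW.
  move: hAC hBS; rewrite !ler_norml => /andP[? ?] /andP[? ?].
  by lra.
have [i1 E1] := Rintegral_powR_subr0 p1 (p1 + d) mu mid1 mu0.
have [i2 E2] := Rintegral_powR_subr0 p1 p2 mu p12 mu0.
have mr0 : mu - rho != 0 by rewrite lt_eqF// subr_lt0.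
have [i3 E3] := Rintegral_powR_subr p1 (p1 + d) p2 (mu - rho) mid1 mid2 mr0.
have mu_neq0 : mu != 0 by rewrite gt_eqF.
have [i4 E4] := Rintegral_powR_subr p1 (p1 + d) p2 mu mid1 mid2 mu_neq0.
have addK' : p1 + d - p1 = d by rewrite addrAC subrr add0r.
rewrite addK' in E1 E3 E4.
have splitD : `]p1, p2] = `]p1, p1 + d] `|` `]p1 + d, p2] :> set R.
  by rewrite -itv_bndbnd_setU// bnd_simp// ltW.
have fin : lebesgue_measure.-integrable `]p1, p1 + d] (EFin \o f T).
  by apply: integrableS (fi T) => //; rewrite splitD; exact: subsetUl.
have fif : lebesgue_measure.-integrable `]p1 + d, p2] (EFin \o f T).
  by apply: integrableS (fi T) => //; rewrite splitD; exact: subsetUr.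
have -> : \int[lebesgue_measure]_(p in `]p1, p2]) f T p =
    \int[lebesgue_measure]_(p in `]p1, p1 + d]) f T p +
    \int[lebesgue_measure]_(p in `]p1 + d, p2]) f T p.
  rewrite splitD Rintegral_setU//; first by rewrite -splitD.
  apply/disj_setPS => x [/=]; rewrite !in_itv/= => /andP[_ xd] /andP[dx _].
  by have := lt_le_trans dx xd; rewrite ltxx.
have I1 : (c1 * (A p1 / 2) - e1) * (d `^ mu / mu) <=
    \int[lebesgue_measure]_(p in `]p1, p1 + d]) f T p.
  rewrite -E1 -RintegralZl//; apply: le_Rintegral => //.
  exact: (integrableZl _ _ i1).
have I2 : - (e1 * q * d `^ rho) *
      (((p2 - p1) `^ (mu - rho) - d `^ (mu - rho)) / (mu - rho)) +
    - (F * d `^ rho) * (((p2 - p1) `^ mu - d `^ mu) / mu) <=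
    \int[lebesgue_measure]_(p in `]p1 + d, p2]) f T p.
  rewrite -E3 -E4 -!RintegralZl// -RintegralD//; last 2 first.
    exact: (integrableZl _ _ i3).
    exact: (integrableZl _ _ i4).
  apply: le_Rintegral => //.
  have mI : measurable (`]p1 + d, p2] : set (measurableTypeR R)) by [].
  exact: (integrableD mI (integrableZl mI _ i3) (integrableZl mI _ i4)).
apply: le_trans (lerD I1 I2).
have X0 : 0 < d `^ mu by rewrite powR_gt0.
have drE : d `^ rho = d `^ mu * d `^ (rho - mu).
  by rewrite -powRD ?(gt_eqF dgt0) ?implybT//; congr (_ `^ _); ring.
have dmrE : d `^ (mu - rho) = (d `^ (rho - mu))^-1.
  by rewrite -powRN opprB.
have L20 : 0 < (p2 - p1) `^ (mu - rho) by rewrite powR_gt0.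
have Z0 : 0 < d `^ (rho - mu) by rewrite powR_gt0.
rewrite dmrE drE.
set X := d `^ mu in X0 *; set Z := d `^ (rho - mu) in Z0 dsmall *.
set L2 := _ `^ (mu - rho) in L20 *.
have -> : (c1 * (A p1 / 2) - e1) * (X / mu) +
    (- (e1 * q * (X * Z)) * ((L2 - Z^-1) / (mu - rho)) +
     - (F * (X * Z)) * (((p2 - p1) `^ mu - X) / mu)) =
    c0 * X - e1 * E * X + e1 * q * X * Z * L2 / (rho - mu) - F' * Z * X
    + F * X * Z * X / mu.
  rewrite c0E /E /F' -[mu - rho]opprB; field.
  by rewrite (gt_eqF mu0) (gt_eqF Z0) (gt_eqF rm0).
have -> : e1 * E = c0 / 2 by rewrite e1E; field; rewrite (gt_eqF E0).
have T1 : 0 <= e1 * q * X * Z * L2 / (rho - mu).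
  by apply: divr_ge0; [rewrite !mulr_ge0// ltW|exact: ltW].
have T2 : 0 <= F * X * Z * X / mu.
  by apply: divr_ge0; [rewrite !mulr_ge0// ltW|exact: ltW].
have T3 : F' * Z * X <= c0 / 4 * X by rewrite ler_pM2r.
by lra.
Unshelve. all: by end_near.
Qed.

(** Averaging over the frequencies T * x, with x in [0, 1], replaces the
    oscillating factor k (T * h p) by its triangular mean. *)
Lemma triangle_mean_oscillatory {R : realType} (D : set R) (a h k : R -> R) (T : R) :
  measurable D -> lebesgue_measure.-integrable D (EFin \o a) ->
  measurable_fun D h -> continuous k -> (forall x, `|k x| <= 1) ->
  [/\ lebesgue_measure.-integrable `[0, 1]
        (fun x => ((1 - x) *
          \int[lebesgue_measure]_(p in D) (a p * k (T * x * h p)))%:E),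
      lebesgue_measure.-integrable D
        (fun p => (a p * triangle_mean k (T * h p))%:E) &
      \int[lebesgue_measure]_(x in `[0, 1]) ((1 - x) *
          \int[lebesgue_measure]_(p in D) (a p * k (T * x * h p))) =
      \int[lebesgue_measure]_(p in D) (a p * triangle_mean k (T * h p))].
Proof.
move=> mD ia mh ck k1.
pose K (z : measurableTypeR R * measurableTypeR R) := k (T * z.1 * (h \_ D) z.2).
have mK : measurable_fun setT K.
  apply: (measurableT_comp (continuous_measurable_fun ck)).
  apply: measurable_funM.
    by apply: measurable_funM => //; exact: measurable_fst.
  apply: (measurableT_comp _ measurable_snd).
  exact/(measurable_restrictT _ mD).
have iw : lebesgue_measure.-integrable `[0, 1] (EFin \o (fun x : R => 1 - x)).
  by apply: integrable_unit_itv => x; apply: cvgB; [exact: cvg_cst|exact: cvg_id].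
have m01 : measurable (`[0, 1]%classic : set (measurableTypeR R)) by [].
have [i1 i2 E] := Rintegral_fubini_kernel (@lebesgue_measure R) (@lebesgue_measure R)
  _ _ _ _ K m01 mD iw ia mK (fun z => k1 _).
have FE (x : R) : \int[lebesgue_measure]_(y in D) (a y * K (x, y)) =
    \int[lebesgue_measure]_(p in D) (a p * k (T * x * h p)).
  by apply: eq_Rintegral => p pD; rewrite /K /= patchE pD.
have GE (p : R) : p \in D ->
    \int[lebesgue_measure]_(x in `[0, 1]) ((1 - x) * K (x, p)) =
    triangle_mean k (T * h p).
  move=> pD; apply: eq_Rintegral => x _; rewrite /K /= patchE pD.
  by rewrite mulrA [T * x]mulrC.
split.
- by apply: eq_integrable i1 => // x _ /=; rewrite FE.
- by apply: eq_integrable i2 => // p pD /=; rewrite GE.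
- under eq_Rintegral do rewrite -FE.
  by rewrite E; apply: eq_Rintegral => p pD; rewrite GE.
Qed.

(** A function that is o (w ^ (- alpha)) at infinity and bounded has averages
    that are o (T ^ (- alpha)): low frequencies only contribute a multiple of
    T ^ (- beta), which is negligible when alpha < beta. The condition alpha < 1
    makes w ^ (- alpha) integrable at 0. *)
Lemma triangle_mean_decay {R : realType} (G : R -> R) (alpha beta K : R) :
  0 < alpha -> alpha < 1 -> 0 < beta -> beta < 1 ->
  (forall w, `|G w| <= K) ->
  (forall e, 0 < e -> \forall w \near +oo, w `^ alpha * `|G w| <= e) ->
  (forall T, lebesgue_measure.-integrable `[0, 1]
    (fun x => ((1 - x) * G (T * x))%:E)) ->
  forall e, 0 < e -> exists2 C, 0 < C & forall T, 0 < T ->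
    \int[lebesgue_measure]_(x in `[0, 1]) ((1 - x) * G (T * x)) <=
      e * T `^ (- alpha) + C * T `^ (- beta).
Proof.
move=> al0 al1 be0 be1 GK Gsmall iG e e0.
have oma : 0 < 1 - alpha by rewrite subr_gt0.
have omb : 0 < 1 - beta by rewrite subr_gt0.
have K0 : 0 <= K := le_trans (normr_ge0 _) (GK 0).
have e'0 : 0 < e * (1 - alpha) by rewrite mulr_gt0.
have [W0 [_ HW]] := Gsmall _ e'0.
(* Below W the bound K on G is turned into a multiple of w ^ (- beta), which
   is integrable at 0. *)
pose W := Num.max W0 1.
have W1 : 0 < W by rewrite lt_max ltr01 orbT.
pose C := (K + 1) * W `^ beta / (1 - beta).
exists C; first by rewrite divr_gt0// mulr_gt0// ?powR_gt0// ltr_wpDl.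
move=> T T0.
have bound w : 0 < w -> `|G w| <= e * (1 - alpha) * w `^ (- alpha) +
    (K + 1) * W `^ beta * w `^ (- beta).
  move=> w0; have [wW|wW] := leP w W.
    apply: (@le_trans _ _ (K + 1)); first by apply: le_trans (GK w) _; rewrite lerDl.
    rewrite -[leLHS]add0r; apply: lerD; first by rewrite !mulr_ge0 ?powR_ge0// ltW.
    rewrite -[leLHS]mulr1 -mulrA ler_wpM2l ?addr_ge0// powRN.
    rewrite ler_pdivlMr ?powR_gt0// mul1r.
    by rewrite ge0_ler_powR// ?nnegrE ltW.
  rewrite -[leLHS]addr0; apply: lerD; last by rewrite !mulr_ge0 ?powR_ge0 ?addr_ge0.
  have : W0 < w by apply: le_lt_trans wW; rewrite le_max lexx.
  move/HW; rewrite powRN ler_pdivlMr ?powR_gt0//.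
  by rewrite mulrC.
have [i1 E1] := Rintegral_powR_subr0 (0 : R) 1 (1 - alpha) ltr01 oma.
have [i2 E2] := Rintegral_powR_subr0 (0 : R) 1 (1 - beta) ltr01 omb.
rewrite subr0 powR1 in E1 E2.
set ka := e * (1 - alpha) * T `^ (- alpha).
set kb := (K + 1) * W `^ beta * T `^ (- beta).
have -> : e * T `^ (- alpha) + C * T `^ (- beta) =
    \int[lebesgue_measure]_(x in `]0, 1])
      (ka * ((x - 0) `^ (1 - alpha - 1)) + kb * ((x - 0) `^ (1 - beta - 1))).
  rewrite RintegralD//; last 2 first.
    exact: (integrableZl _ _ i1).
    exact: (integrableZl _ _ i2).
  rewrite !RintegralZl// E1 E2 /ka /kb /C; field.
  by rewrite (gt_eqF oma) (gt_eqF omb).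
have iG' : lebesgue_measure.-integrable `]0, 1] (fun x => ((1 - x) * G (T * x))%:E).
  by apply: integrableS (iG T) => //; exact: subset_itv_oc_cc.
rewrite -Rintegral_itv_obnd_cbnd//.
apply: le_Rintegral => //.
  have mI : measurable (`]0, 1]%classic : set (measurableTypeR R)) by [].
  exact: (integrableD mI (integrableZl mI _ i1) (integrableZl mI _ i2)).
move=> x; rewrite /= in_itv/= => /andP[x0 x1].
have Tx0 : 0 < T * x by rewrite mulr_gt0.
apply: (@le_trans _ _ `|G (T * x)|).
  apply: le_trans (ler_norm _) _; rewrite normrM -[leRHS]mul1r.
  by rewrite ler_wpM2r// ger0_norm ?subr_ge0// gerBl ltW.
apply: le_trans (bound _ Tx0) _.
rewrite !(powRM _ (ltW T0) (ltW x0)) subr0 /ka /kb !mulrA.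
have s1 (s : R) : 1 - s - 1 = - s by ring.
by rewrite !s1.
Qed.

Lemma le_normr_Rintegral_kernel {d : measure_display} {T : measurableType d}
    {R : realType} (nu : {measure set T -> \bar R}) (D : set T) (a k : T -> R) :
  measurable D -> nu.-integrable D (EFin \o a) ->
  measurable_fun D k -> (forall x, `|k x| <= 1) ->
  `|\int[nu]_(p in D) (a p * k p)| <= \int[nu]_(p in D) `|a p|.
Proof.
move=> mD ia mk k1.
have iak : nu.-integrable D (EFin \o (fun p => a p * k p)).
  apply: (integrableMl mD ia mk).
  by exists 1; split=> // M M1 y _; exact: le_trans (k1 _) (ltW M1).
apply: le_trans; first exact: le_normr_Rintegral.
apply: le_Rintegral => //; [exact: integrable_norm|exact: integrable_norm|].
by move=> p _; rewrite normrM -[leRHS]mulr1 ler_wpM2l.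
Qed.

(** The averages of G cannot be o (T ^ (- mu / rho)), by the lower bound
    obtained from the nonnegative kernel; hence neither can G. *)
Lemma oscillatory_not_little_o {R : realType} (p1 p2 mu rho m M : R)
    (A B h : R -> R) :
  p1 < p2 -> 0 < mu -> mu < rho -> 0 < m -> 0 < M ->
  {within `[p1, p2], continuous A} -> {within `[p1, p2], continuous B} ->
  0 < A p1 -> B p1 = 0 -> measurable_fun `]p1, p2] h ->
  (forall p, p1 < p <= p2 ->
    m * (p - p1) `^ rho <= `|h p| <= M * (p - p1) `^ rho) ->
  let G w :=
    \int[lebesgue_measure]_(p in `]p1, p2])
      ((p - p1) `^ (mu - 1) * A p * cos (w * h p)) -
    \int[lebesgue_measure]_(p in `]p1, p2])
      ((p - p1) `^ (mu - 1) * B p * sin (w * h p)) in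
  ~ (forall e, 0 < e -> \forall w \near +oo, w `^ (mu / rho) * `|G w| <= e).
Proof.
move=> p12 mu0 murho m0 M0 cA cB A0 B0 mh hb G Gsmall.
have rho0 : 0 < rho := lt_trans mu0 murho.
have mD : measurable (`]p1, p2]%classic : set (measurableTypeR R)) by [].
have iA := integrable_powR_continuous _ _ _ _ p12 mu0 cA.
have iB := integrable_powR_continuous _ _ _ _ p12 mu0 cB.
have Tc T := triangle_mean_oscillatory _ _ _ _ T mD iA mh
  (@continuous_cos R) (@cos_max R).
have Ts T := triangle_mean_oscillatory _ _ _ _ T mD iB mh
  (@continuous_sin R) (@sin_max R).
have m01 : measurable (`[0, 1]%classic : set (measurableTypeR R)) by [].
have iG T : lebesgue_measure.-integrable `[0, 1]
    (fun x => ((1 - x) * G (T * x))%:E).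
  have [ic _ _] := Tc T; have [i_s _ _] := Ts T.
  apply: eq_integrable (integrableB m01 ic i_s) => // x _ /=.
  by rewrite -EFinB -mulrBr.
pose f T p := (p - p1) `^ (mu - 1) *
    (A p * triangle_mean cos (T * h p) - B p * triangle_mean sin (T * h p)).
have fi T : lebesgue_measure.-integrable `]p1, p2] (EFin \o f T).
  have [_ ic _] := Tc T; have [_ i_s _] := Ts T.
  apply: eq_integrable (integrableB mD ic i_s) => // p _ /=.
  by rewrite -EFinB /f mulrBr !mulrA.
have meanE T : \int[lebesgue_measure]_(x in `[0, 1]) ((1 - x) * G (T * x)) =
    \int[lebesgue_measure]_(p in `]p1, p2]) f T p.
  have [ic jc Ec] := Tc T; have [i_s js Es] := Ts T.
  under eq_Rintegral do rewrite mulrBr.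
  rewrite RintegralB// Ec Es -RintegralB//; apply: eq_Rintegral => p _.
  by rewrite /f mulrBr !mulrA.
have [c c0 Hc] := triangle_mean_integral_lower _ _ _ _ _ _ _ _ _
  p12 mu0 murho m0 M0 cA cB A0 B0 hb fi.
have mk (k : R -> R) (w : R) : continuous k ->
    measurable_fun `]p1, p2] (fun p => k (w * h p)).
  move=> ck; apply: (measurableT_comp (continuous_measurable_fun ck)).
  by apply: measurable_funM.
have [K GK] : exists K, forall w, `|G w| <= K.
  exists (\int[lebesgue_measure]_(p in `]p1, p2]) `|(p - p1) `^ (mu - 1) * A p| +
    \int[lebesgue_measure]_(p in `]p1, p2]) `|(p - p1) `^ (mu - 1) * B p|) => w.
  apply: le_trans (ler_normB _ _) _; apply: lerD.
    have mc := mk _ w (@continuous_cos R).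
    exact: (le_normr_Rintegral_kernel _ _ _ _ mD iA mc (fun p => cos_max _)).
  have ms := mk _ w (@continuous_sin R).
  exact: (le_normr_Rintegral_kernel _ _ _ _ mD iB ms (fun p => sin_max _)).
have al0 : 0 < mu / rho by rewrite divr_gt0.
have al1 : mu / rho < 1 by rewrite ltr_pdivrMr// mul1r.
(* Any exponent strictly between mu / rho and 1 would do. *)
pose beta := (1 + mu / rho) / 2.
have be0 : 0 < beta by rewrite divr_gt0// addr_gt0.
have be1 : beta < 1 by rewrite ltr_pdivrMr//; lra.
have e0 : 0 < c / 4 / M `^ (mu / rho).
  by rewrite divr_gt0 ?powR_gt0// divr_gt0.
have [C C0 HC] := triangle_mean_decay _ _ _ _ al0 al1 be0 be1 GK Gsmall iG _ e0.
have rm0 : 0 < (rho - mu) / 2 by rewrite divr_gt0// subr_gt0.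
have CM0 : 0 < C * M `^ beta by rewrite mulr_gt0// powR_gt0.
have e20 : 0 < c / 4 / (C * M `^ beta) by rewrite divr_gt0// divr_gt0.
have Hd : \forall d \near 0^'+, C * M `^ beta * d `^ ((rho - mu) / 2) <= c / 4.
  have /cvgrPdist_le/(_ _ e20) := powR_cvg0 rm0.
  apply: filterS => d; rewrite sub0r normrN ger0_norm ?powR_ge0//.
  by rewrite ler_pdivlMr// mulrC.
near (0 : R)^'+ => d.
have d0 : 0 < d by near: d; exact: nbhs_right_gt.
have h1 : c * d `^ mu <= \int[lebesgue_measure]_(p in `]p1, p2])
    f (M * d `^ rho)^-1 p by near: d.
have h2 : C * M `^ beta * d `^ ((rho - mu) / 2) <= c / 4 by near: d.
have dr0 : 0 < d `^ rho by rewrite powR_gt0.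
have Md0 : 0 < M * d `^ rho by rewrite mulr_gt0.
have := HC (M * d `^ rho)^-1; rewrite invr_gt0 => /(_ Md0).
rewrite meanE => /(le_trans h1).
have powVN r : (M * d `^ rho)^-1 `^ (- r) = M `^ r * d `^ (rho * r).
  rewrite -powR_inv1 ?(ltW Md0)// -powRrM mulN1r opprK.
  by rewrite (powRM _ (ltW M0) (ltW dr0)) powRrM.
(* At T = (M d ^ rho) ^ -1 the lower bound c d ^ mu and the main term of the
   upper bound have the same order, with e making the latter at most c / 4. *)
rewrite !powVN.
have -> : rho * (mu / rho) = mu by field; rewrite gt_eqF.
have -> : rho * beta = mu + (rho - mu) / 2.
  by rewrite /beta; field; rewrite gt_eqF.
rewrite powRD ?(gt_eqF d0) ?implybT//.
have X0 : 0 < d `^ mu by rewrite powR_gt0.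
have MA0 : 0 < M `^ (mu / rho) by rewrite powR_gt0.
rewrite !mulrA divfK ?gt_eqF//.
have : C * M `^ beta * d `^ ((rho - mu) / 2) * d `^ mu <= c / 4 * d `^ mu.
  by rewrite ler_pM2r.
have := mulr_gt0 c0 X0.
lra.
Unshelve. all: by end_near. Qed.

(** * The phase near its stationary point *)

Lemma powR_subr_cvg0 {R : realType} (a s : R) : 0 < s ->
  (x - a) `^ s @[x --> a^'+] --> (0 : R).
Proof.
move=> s0.
apply: (@cvg_comp _ _ _ (fun x : R => x - a) (fun x => x `^ s) _ (0^'+)); last exact: powR_cvg0.
move=> V [e /= e0 eV]; exists e => //= y /= ye ay; apply: eV => /=.
  by rewrite sub0r normrN -normrN opprB.
by rewrite subr_gt0.
Qed.

Lemma within_continuous_powR_subr {R : realType} (a b s : R) : a < b -> 0 < s ->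
  {within `[a, b], continuous (fun x : R => (x - a) `^ s)}.
Proof.
move=> ab s0.
have C x : a < x -> {for x, continuous (fun y => (y - a) `^ s)}.
  move=> ax; apply/differentiable_continuous/derivable1_diffP.
  by have [] := is_derive_powR_subr a s x ax.
apply/(continuous_within_itvP _ ab); split.
- by move=> x; rewrite in_itv/= => /andP[ax _]; exact: C.
- by rewrite subrr powR0 ?gt_eqF//; exact: powR_subr_cvg0.
- by apply: cvg_at_left_filter; exact: C.
Qed.

(** Cauchy's mean value theorem for psi and (p - p1) ^ rho: the quotient of the
    increments is psit c / rho for some c. *)
Lemma stationary_phase_two_sided {R : realType} (p1 p2 rho m M : R)
    (psi psit : R -> R) :
  p1 < p2 -> 0 < rho ->
  (forall p, p1 <= p <= p2 -> derivable psi p 1) ->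
  (forall p, p1 < p < p2 -> psi^`() p = (p - p1) `^ (rho - 1) * psit p) ->
  (forall p, p1 <= p <= p2 -> m <= `|psit p| <= M) ->
  forall p, p1 < p <= p2 ->
    m / rho * (p - p1) `^ rho <= `|psi p - psi p1| <= M / rho * (p - p1) `^ rho.
Proof.
move=> p12 rho0 dpsi psiE psitb p /andP[p1p pp2].
have sub x : x \in `]p1, p[%R -> p1 < x < p2.
  by rewrite in_itv/= => /andP[-> xp]; exact: lt_le_trans pp2.
have subW x : x \in `]p1, p[%R -> p1 <= x <= p2.
  by move=> /sub /andP[? ?]; rewrite !ltW.
have cpsi : {within `[p1, p], continuous psi}.
  apply: derivable_within_continuous => x; rewrite in_itv/= => /andP[x1 xp].
  by apply: dpsi; rewrite x1 (le_trans xp).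
have dpsi' x : x \in `]p1, p[%R -> is_derive x 1 psi (psi^`() x).
  by move=> /subW /dpsi d; apply: DeriveDef => //; rewrite derive1E.
have dpow x : x \in `]p1, p[%R ->
    is_derive x 1 (fun y => (y - p1) `^ rho) (rho * (x - p1) `^ (rho - 1)).
  by move=> /sub/andP[p1x _]; exact: is_derive_powR_subr.
have dpow0 x : x \in `]p1, p[%R -> rho * (x - p1) `^ (rho - 1) != 0.
  by move=> /sub/andP[p1x _]; rewrite gt_eqF// mulr_gt0// powR_gt0// subr_gt0.
have [c cp] := cauchy_MVT p1p cpsi (within_continuous_powR_subr _ _ _ p1p rho0)
  dpsi' dpow dpow0.
have /andP[p1c cp2] := sub _ cp.
have xc0 : 0 < (c - p1) `^ (rho - 1) by rewrite powR_gt0// subr_gt0.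
have xr0 : 0 < (p - p1) `^ rho by rewrite powR_gt0// subr_gt0.
rewrite psiE ?p1c// subrr powR0 ?gt_eqF// subr0 => E.
have -> : psi p - psi p1 = psit c / rho * (p - p1) `^ rho.
  apply: (mulIf (invr_neq0 (lt0r_neq0 xr0))).
  by rewrite -E mulfK ?gt_eqF//; field; rewrite !gt_eqF.
rewrite !normrM (gtr0_norm xr0) normfV (gtr0_norm rho0).
have /andP[cm cM] := psitb _ (subW _ cp).
by rewrite !ler_pM2r ?invr_gt0// cm.
Qed.

(** * From the complex integral to real integrals *)

(** The real and imaginary parts are additive and 1-Lipschitz for the modulus. *)
Lemma within_continuous_Re_Im {R : realType} (D : set R) (f : R -> R[i]) :
  {within D, continuous (f : R -> R[i]^o)} ->
  {within D, continuous (Re_fun f)} /\ {within D, continuous (Im_fun f)}.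
Proof.
move=> cf; have key (g : R[i] -> R) :
    (forall z, (`|g z|)%:C <= `|z|) -> {morph g : x y / x - y} ->
    {within D, continuous (g \o f)}.
  move=> g1 gB x; apply/cvgrPdist_le => e e0.
  have := cf x; move=> /(@cvgrPdist_le _ (R[i]^o)) /(_ e%:C).
  rewrite ltcR => /(_ e0); apply: filterS => y /= fy.
  by rewrite -gB -lecR; exact: le_trans (g1 _) fy.
split.
- apply: (key (@complex.Re R)); first exact: normc_ge_Re.
  by move=> [a b] [c d].
- apply: (key (@complex.Im R)); last by move=> [a b] [c d].
  move=> [a b]; rewrite normc_def lecR /= -sqrtr_sqr ler_sqrt ?addr_ge0 ?sqr_ge0//.
  by rewrite lerDr sqr_ge0.
Qed.

(** Cauchy-Schwarz in the plane, for a vector (a, b) that has the same length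
    as z, such as a rotation of it. *)
Lemma cauchy_schwarz_normc {R : realType} (a b : R) (z w : R[i]) :
  a ^+ 2 + b ^+ 2 = complex.Re z ^+ 2 + complex.Im z ^+ 2 ->
  `|a * complex.Re w + b * complex.Im w| <= Normc.normc z * Normc.normc w.
Proof.
case: z w => [z1 z2] [x y] /= E.
rewrite -sqrtrM ?addr_ge0 ?sqr_ge0// -sqrtr_sqr ler_sqrt; last first.
  by rewrite mulr_ge0// addr_ge0 ?sqr_ge0.
rewrite -E -subr_ge0.
rewrite (_ : _ - _ = (a * y - b * x) ^+ 2) ?sqr_ge0//; ring.
Qed.

Lemma limf_esup_le0_near {R : realType} (f : R -> R) :
  ~~ (0 < limf_esup (EFin \o f) (pinfty_nbhs R))%E ->
  forall e, 0 < e -> \forall w \near +oo, f w <= e.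
Proof.
rewrite -leNgt => le0 e e0.
have : (limf_esup (EFin \o f) (pinfty_nbhs R) < e%:E)%E.
  by apply: le_lt_trans le0 _; rewrite lte_fin.
rewrite limf_esupE => /ereal_inf_lt[_ [V FV <-]] Ve.
apply: filterS FV => w Vw; rewrite -lee_fin; apply: le_trans (ltW Ve).
by apply: ereal_sup_ubound; exists w.
Qed.

(** The left-hand side is the modulus of the real part of the oscillatory
    integral multiplied by the conjugate of (r + i j) exp (i w t). This rotation
    makes the phase vanish where psi = t and, for r + i j = ut p1, makes the
    amplitude real and positive at p1. *)
Lemma oscillatory_integral_Re_rotated {R : realType} (p1 p2 mu : R)
    (U ut : R -> R[i]) (psi : R -> R) (r j w t : R) :
  p1 < p2 -> 0 < mu ->
  {within `[p1, p2], continuous (Re_fun ut)} ->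
  {within `[p1, p2], continuous (Im_fun ut)} ->
  {within `[p1, p2], continuous psi} ->
  (forall p, p1 < p <= p2 -> U p = ((p - p1) `^ (mu - 1))%:C * ut p) ->
  `| \int[lebesgue_measure]_(p in `]p1, p2]) ((p - p1) `^ (mu - 1) *
        (r * Re_fun ut p + j * Im_fun ut p) * cos (w * (psi p - t))) -
     \int[lebesgue_measure]_(p in `]p1, p2]) ((p - p1) `^ (mu - 1) *
        (r * Im_fun ut p - j * Re_fun ut p) * sin (w * (psi p - t))) |
  <= Normc.normc (r +i* j) * Normc.normc (oscillatory_integral p1 p2 U psi w).
Proof.
move=> p12 mu0 cre cim cpsi UE.
have mD : measurable (`]p1, p2]%classic : set (measurableTypeR R)) by [].
have ir := integrable_powR_continuous _ _ _ _ p12 mu0 cre.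
have ii := integrable_powR_continuous _ _ _ _ p12 mu0 cim.
have mpsi : measurable_fun `]p1, p2] psi.
  have mg : measurable_fun `[p1, p2] psi by exact: subspace_continuous_measurable_fun.
  by apply: measurable_funS mg => //; exact: subset_itv_oc_cc.
have ik (a k : R -> R) (s : R) : continuous k -> (forall x, `|k x| <= 1) ->
    lebesgue_measure.-integrable `]p1, p2] (EFin \o a) ->
    lebesgue_measure.-integrable `]p1, p2] (EFin \o (fun p => a p * k (w * (psi p - s)))).
  move=> ck k1 ia; apply: (integrableMl mD ia).
    apply: (measurableT_comp (continuous_measurable_fun ck)).
    by apply: measurable_funM => //; exact: measurable_funB.
  by exists 1; split=> // M M1 y _; exact: le_trans (k1 _) (ltW M1).
pose P p := (p - p1) `^ (mu - 1).
pose X (p : R) := P p * Re_fun ut p * cos (w * (psi p - 0)) -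
                  P p * Im_fun ut p * sin (w * (psi p - 0)).
pose Y (p : R) := P p * Re_fun ut p * sin (w * (psi p - 0)) +
                  P p * Im_fun ut p * cos (w * (psi p - 0)).
have iX : lebesgue_measure.-integrable `]p1, p2] (EFin \o X).
  exact: (integrableB mD (ik _ _ 0 (@continuous_cos R) (@cos_max R) ir)
                         (ik _ _ 0 (@continuous_sin R) (@sin_max R) ii)).
have iY : lebesgue_measure.-integrable `]p1, p2] (EFin \o Y).
  exact: (integrableD mD (ik _ _ 0 (@continuous_sin R) (@sin_max R) ir)
                         (ik _ _ 0 (@continuous_cos R) (@cos_max R) ii)).
have -> : oscillatory_integral p1 p2 U psi w =
    (\int[lebesgue_measure]_(p in `]p1, p2]) X p) +i*
    (\int[lebesgue_measure]_(p in `]p1, p2]) Y p).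
  congr (_ +i* _); apply: eq_Rintegral => p; rewrite inE/= in_itv/= => pD;
    rewrite /X /Y /Re_fun /Im_fun UE// subr0 /P;
    by case: (ut p) => a b /=; ring.
have iA : lebesgue_measure.-integrable `]p1, p2]
    (EFin \o (fun p => P p * (r * Re_fun ut p + j * Im_fun ut p))).
  apply: eq_integrable (integrableD mD (integrableZl mD r ir) (integrableZl mD j ii)) => //.
  by move=> p _ /=; rewrite -!EFinM -EFinD /P; congr EFin; ring.
have iB : lebesgue_measure.-integrable `]p1, p2]
    (EFin \o (fun p => P p * (r * Im_fun ut p - j * Re_fun ut p))).
  apply: eq_integrable (integrableB mD (integrableZl mD r ii) (integrableZl mD j ir)) => //.
  by move=> p _ /=; rewrite -!EFinM -EFinB /P; congr EFin; ring.
rewrite -RintegralB//; last 2 first.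
  exact: ik (@continuous_cos R) (@cos_max R) iA.
  exact: ik (@continuous_sin R) (@sin_max R) iB.
(* a - i b is the product of the conjugate of r + i j with exp (- i w t). *)
pose a := r * cos (w * t) - j * sin (w * t).
pose b := r * sin (w * t) + j * cos (w * t).
have -> : \int[lebesgue_measure]_(p in `]p1, p2])
     ((p - p1) `^ (mu - 1) * (r * Re_fun ut p + j * Im_fun ut p) * cos (w * (psi p - t)) -
      (p - p1) `^ (mu - 1) * (r * Im_fun ut p - j * Re_fun ut p) * sin (w * (psi p - t))) =
   a * \int[lebesgue_measure]_(p in `]p1, p2]) X p +
   b * \int[lebesgue_measure]_(p in `]p1, p2]) Y p.
  rewrite -!RintegralZl// -RintegralD//; last 2 first.
    exact: (integrableZl mD _ iX).
    exact: (integrableZl mD _ iY).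
  apply: eq_Rintegral => p _.
  by rewrite /X /Y !subr0 mulrBr cosB sinB /a /b /P; ring.
apply: (cauchy_schwarz_normc a b (r +i* j) (_ +i* _)) => /=.
have := cos2Dsin2 (w * t); rewrite /a /b => cs.
transitivity ((r ^+ 2 + j ^+ 2) * (cos (w * t) ^+ 2 + sin (w * t) ^+ 2)); first by ring.
by rewrite cs mulr1.
Qed.

Theorem theorem3p10 (R : realType) (p1 p2 : R) (I : set R) (rho mu p0 : R)
  (psi psit : R -> R) (U ut : R -> R[i])
  (p1_lt_p2 : p1 < p2)
  (I_open : open I) (I_interval : is_interval I) (I_segment : `[p1, p2] `<=` I)
  (rho_gt1 : 1 < rho) (mu_gt0 : 0 < mu) (mu_le1 : mu <= 1) (I_p0 : I p0)
  (psiP : assumption_P I p0 rho psi psit)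
  (UA : assumption_A p1 p2 mu U ut)
  (psi'_left : monotone_on [set p | I p /\ p < p0] psi^`())
  (psi'_right : monotone_on [set p | I p /\ p0 < p] psi^`())
  (psit_right_C1 : p0 = p1 -> C1_segment p1 p2 psit)
  (ut_C1 : complex_C1_segment p1 p2 ut)
  (ut_p1_neq0 : ut p1 != 0) :
  p0 = p1 ->
  (0 < limf_esup
         (fun omega : R =>
            (omega `^ (mu / rho)
             * Normc.normc (oscillatory_integral p1 p2 U psi omega))%:E)
         (pinfty_nbhs R))%E.
Proof.
move=> p01; subst p0; apply/negPn/negP => /limf_esup_le0_near small.
have [cre cim] := within_continuous_Re_Im _ _ (A_continuous UA).
have inI p : p1 <= p <= p2 -> I p by move=> pp; apply: I_segment; rewrite /= in_itv.
have dpsi p : p1 <= p <= p2 -> derivable psi p 1.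
  by move=> /inI /(P_C1 psiP)[].
have cpsi : {within `[p1, p2], continuous psi}.
  by apply: derivable_within_continuous => x; rewrite in_itv/=; exact: dpsi.
have cabs := continuous_subspaceW I_segment (P_continuous psiP).
have [xm xmI psimin] := EVT_min (ltW p1_lt_p2) cabs.
have [xM xMI psimax] := EVT_max (ltW p1_lt_p2) cabs.
rewrite in_itv/= in xmI; rewrite in_itv/= in xMI.
have rho0 : 0 < rho by rewrite (lt_trans ltr01).
have m0 : 0 < `|psit xm| / rho.
  by rewrite divr_gt0// normr_gt0; apply: (P_neq0 psiP); exact: inI.
have M0 : 0 < `|psit xM| / rho.
  by rewrite divr_gt0// normr_gt0; apply: (P_neq0 psiP); exact: inI.
have psi'E p : p1 < p < p2 -> psi^`() p = (p - p1) `^ (rho - 1) * psit p.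
  move=> /andP[p1p pp2]; rewrite (P_factor psiP); last by apply: inI; rewrite !ltW.
  by rewrite gtr0_norm// subr_gt0.
have psitb p : p1 <= p <= p2 -> `|psit xm| <= `|psit p| <= `|psit xM|.
  by move=> pp; rewrite psimin ?psimax ?in_itv.
(* A + i B is ut multiplied by the conjugate of ut p1. *)
have hb := stationary_phase_two_sided _ _ _ _ _ _ _ p1_lt_p2 rho0 dpsi psi'E psitb.
pose r := complex.Re (ut p1); pose j := complex.Im (ut p1).
pose A p := r * Re_fun ut p + j * Im_fun ut p.
pose B p := r * Im_fun ut p - j * Re_fun ut p.
have cA : {within `[p1, p2], continuous A}.
  move=> x; apply: cvgD; (apply: cvgM; first exact: cvg_cst); [exact: cre|exact: cim].
have cB : {within `[p1, p2], continuous B}.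
  move=> x; apply: cvgB; (apply: cvgM; first exact: cvg_cst); [exact: cim|exact: cre].
have normE : 0 < Normc.normc (ut p1).
  rewrite lt_neqAle eq_sym; apply/andP; split; last first.
    by rewrite /Normc.normc; case: (ut p1) => *; exact: sqrtr_ge0.
  by apply: contra ut_p1_neq0 => /eqP/Normc.eq0_normc ->.
have A0 : 0 < A p1.
  move: normE; rewrite /A /r /j /Re_fun /Im_fun; case: (ut p1) => a b /=.
  by rewrite sqrtr_gt0 !expr2.
have B0 : B p1 = 0 by rewrite /B /Re_fun /Im_fun -/r -/j mulrC subrr.
have mh : measurable_fun `]p1, p2] (fun p => psi p - psi p1).
  apply: measurable_funB => //.
  have mg : measurable_fun `[p1, p2] psi by exact: subspace_continuous_measurable_fun.
  by apply: measurable_funS mg => //; exact: subset_itv_oc_cc.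
have murho : mu < rho by rewrite (le_lt_trans mu_le1).
apply: (oscillatory_not_little_o _ _ _ _ _ _ A B _ p1_lt_p2 mu_gt0 murho m0 M0
  cA cB A0 B0 mh hb) => e e0.
have e'0 : 0 < e / Normc.normc (ut p1) by rewrite divr_gt0.
apply: filterS (small _ e'0) => w; rewrite ler_pdivlMr// => /(le_trans _); apply.
rewrite -mulrA ler_wpM2l ?powR_ge0// [leRHS]mulrC.
rewrite (_ : ut p1 = r +i* j); last by rewrite /r /j; case: (ut p1).
exact: (oscillatory_integral_Re_rotated _ _ _ _ _ _ r j w (psi p1) p1_lt_p2 mu_gt0
  cre cim cpsi (A_factor UA)).
Qed.
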